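(* Let $(H,\langle\cdot,\cdot\rangle)$ be a real Hilbert space with norm $\|\cdot\|$, let $A$ be a self-adjoint operator on $H$ with domain $D(A)\subset H$, let $(B,\|\cdot\|_B)$ be a real Banach space, and let $N:(B,\|\cdot\|_B)\to H$ be a (not necessarily linear) operator. Assume: (A1) $D(A)\subset B\subset H$ (as linear subspaces) and the inclusion $(D(A),\|\cdot\|_A)\hookrightarrow (B,\|\cdot\|_B)$ is compact, where $\|\cdot\|_A$ is the graph norm of $A$; (A2) there is $\alpha>0$ such that $\langle Au,u\rangle\ge \alpha\|u\|^2$ for all $u\in D(A)$; (N1) $N$ is of class $C^1$, and $N'(u)$ is symmetric for every $u\in B$; (N2) there exist constants $0<\beta<1$, $0<\gamma<\alpha$ and $\delta>0$ such that (i) $\|N(u)\|<\beta\|Au\|+\delta$ for all $u\in D(A)$; (ii) $\langle N'(u)h,h\rangle<\gamma\|h\|^2$ for all $u\in D(A)$ and all $h\in D(A)\setminus\{0\}$. Then there exists exactly one $x\in D(A)$ such that $Ax=N(x)$.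
   Context: Self-adjoint operators are linear, densely defined and possibly unbounded. For a self-adjoint operator $A$ on $H$, the domain $D(A)$ is a real Hilbert space with the scalar product $\langle u,v\rangle_A=\langle u,v\rangle+\langle Au,Av\rangle$, and $\|\cdot\|_A$ denotes the corresponding norm (the graph norm). $C^1$ is meant in the Fréchet sense for maps from $(B,\|\cdot\|_B)$ to $H$, so $N'(u):B\to H$ is bounded and linear for each $u \in B$. Symmetry of $N'(u)$ means $\langle N'(u)h,k\rangle=\langle h,N'(u)k\rangle$ for all $h,k\in B$, where elements of $B$ are regarded as elements of $H$. *)

(* Defs.v *)
From HB Require Import structures.
From mathcomp Require Import all_boot all_order all_algebra.
From mathcomp Require Import all_classical all_reals all_analysis.

Set Implicit Arguments.
Unset Strict Implicit.
Unset Printing Implicit Defensive.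

Import Order.TTheory GRing.Theory Num.Theory.
Import numFieldNormedType.Exports.

Local Open Scope classical_set_scope.
Local Open Scope ring_scope.

(* The dot product [ip] induces the norm of [H]; a real Hilbert space is a
   completeNormedModType equipped with such an [ip]. *)
Definition norm_of_dot (R : realType) (H : normedModType R)
    (ip : {dot H for (@idfun R)}) : Prop :=
  forall u : H, `|u| = Num.sqrt (ip u u).

(* The operator acts on [dom A] only: the values of [op A] outside [dom A] are
   junk, and no notion below depends on them. *)
Record unbounded_operator (R : realType) (H : normedModType R) :=
  UnboundedOperator { dom : set H ; op :> H -> H }.

Section Operators.
Context {R : realType} {H : normedModType R}.
Implicit Types (ip : {dot H for (@idfun R)}) (A : unbounded_operator H).

Definition linear_on_dom A : Prop :=
  dom A 0 /\
  forall (a : R) (u v : H), dom A u -> dom A v ->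
    dom A (a *: u + v) /\ A (a *: u + v) = a *: A u + A v.

Definition graph A : set (H * H) := [set p | dom A p.1 /\ p.2 = A p.1].

(* (v, w) belongs to the graph of the adjoint iff v is in its domain and is
   mapped to w; this relation is functional as soon as [dom A] is dense. *)
Definition adjoint_graph ip A : set (H * H) :=
  [set p | forall u : H, dom A u -> ip (A u) p.1 = ip u p.2].

Definition self_adjoint ip A : Prop :=
  [/\ linear_on_dom A, dense (dom A) & adjoint_graph ip A = graph A].

Definition graph_dot ip A (u v : H) : R := ip u v + ip (A u) (A v).

Definition graph_norm ip A (u : H) : R := Num.sqrt (graph_dot ip A u u).

(* [iB] realizes [B] as a linear subspace of [H]; for a set [S] contained in the
   range of [iB], [iB @^-1` S] is [S] seen as a subset of [B]. *)
Definition compact_inclusion ip A (B : normedModType R) (iB : B -> H) : Prop :=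
  dom A `<=` range iB /\
  forall S : set H, S `<=` dom A ->
    (exists M : R, forall u : H, S u -> graph_norm ip A u <= M) ->
    precompact (iB @^-1` S).

End Operators.

(* Meaningful for bounded linear [f] only: otherwise the supremum may be the
   default value 0 of [sup]. *)
Definition opnorm (R : realType) (V W : normedModType R) (f : V -> W) : R :=
  sup [set `|f h| | h in [set h : V | `|h| <= 1]].

(* [differentiable] is Frechet differentiability and includes the continuity of
   the linear map ['d f u]. *)
Definition continuously_differentiable (R : realType) (V W : normedModType R)
    (f : V -> W) : Prop :=
  (forall u : V, differentiable f u) /\
  (forall u : V,
     opnorm (fun h : V => 'd f v h - 'd f u h) @[v --> u] --> (0 : R)).

(* Main.v *)
(* Let K : H -> B be the inverse of A, which is compact, and F = N o K, so that the
   solutions of A x = N x are the x = A^-1 w with w = F w. On a ball of radius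
   rho = delta / (1 - beta), all the maps 1 - t F with 0 <= t <= 1 are expansive with
   a common constant: monotonicity (gamma < alpha) controls |A^-1 (v - w)| by the
   image difference r, Ehrling's inequality
   |K z| <= eps |z| + C |A^-1 z| upgrades this to |K (v - w)| <= eps |v - w| + C' |r|,
   and N is Lipschitz on the relatively compact K-image of the ball. Uniform
   expansiveness and the growth bound (i) on N allow one to solve w - t F w = y for t
   increasing from 0 to 1 in finitely many equal steps, each by Banach's fixed point
   theorem; no derivative has to be inverted. Monotonicity gives uniqueness. *)
From HB Require Import structures.
Require Import Defs.
From mathcomp Require Import all_boot all_order all_algebra.
From mathcomp Require Import all_classical all_reals all_analysis.
From mathcomp Require Import ring lra.

Set Implicit Arguments.
Unset Strict Implicit.
Unset Printing Implicit Defensive.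

Import Order.TTheory GRing.Theory Num.Theory.
Import numFieldNormedType.Exports.
Local Open Scope classical_set_scope.
Local Open Scope ring_scope.

(** * Inner products and the Cauchy-Schwarz inequality *)

Section Dot.
Context {R : realType} {H : normedModType R} {ip : {dot H for (@idfun R)}}.
Implicit Types u v w : H.

Lemma dotC u v : ip u v = ip v u.
Proof. by have := @hermitian_subproof _ _ _ _ ip u v; rewrite expr0 mul1r. Qed.

Lemma dotDr u v w : ip u (v + w) = ip u v + ip u w.
Proof. exact: linearDr. Qed.

Lemma dotZr (a : R) u v : ip u (a *: v) = a * ip u v.
Proof. exact: linearZr_LR. Qed.

Lemma dotDl u v w : ip (u + v) w = ip u w + ip v w.
Proof. by rewrite dotC dotDr !(dotC w). Qed.

Lemma dotZl (a : R) u v : ip (a *: u) v = a * ip u v.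
Proof. by rewrite dotC dotZr dotC. Qed.

Lemma dotBl u v w : ip (u - v) w = ip u w - ip v w.
Proof. by rewrite -scaleN1r dotDl dotZl mulN1r. Qed.

Lemma dotBr u v w : ip u (v - w) = ip u v - ip u w.
Proof. by rewrite dotC dotBl !(dotC u). Qed.

Hypothesis hH : norm_of_dot ip.

Lemma sqr_norm_dot u : `|u| ^+ 2 = ip u u.
Proof.
rewrite hH sqr_sqrtr//; have [->|u0] := eqVneq u 0.
  by rewrite linear0r.
exact/ltW/neq0_dnorm_gt0.
Qed.

Lemma parallelogram u v :
  `|u - v| ^+ 2 = 2 * `|u| ^+ 2 + 2 * `|v| ^+ 2 - `|u + v| ^+ 2.
Proof.
rewrite !sqr_norm_dot !dotBl !dotBr !dotDl !dotDr (dotC v u); ring.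
Qed.

Lemma dot_le_norm u v : `|ip u v| <= `|u| * `|v|.
Proof.
have [->|v0] := eqVneq v 0.
  by rewrite linear0r normr0 mulr_ge0.
have v_gt0 : 0 < ip v v by exact: neq0_dnorm_gt0.
have := sqr_ge0 `|u - (ip u v / ip v v) *: v|.
rewrite sqr_norm_dot !dotBl !dotBr !dotZl !dotZr (dotC v u) mulfVK ?gt_eqF//.
rewrite subrr subr0 mulrAC -expr2 subr_ge0 ler_pdivrMr// => uv.
rewrite -(@ler_pXn2r _ 2)// ?nnegrE ?mulr_ge0//.
by rewrite real_normK ?num_real// exprMn !sqr_norm_dot.
Qed.

Lemma dot_continuous v : continuous (ip v).
Proof.
move=> u; apply/cvgrPdist_le => e e0; near=> w.
rewrite -dotBr (le_trans (dot_le_norm _ _))// mulrC.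
rewrite (@le_trans _ _ (`|u - w| * (`|v| + 1)))//.
  by rewrite ler_wpM2l// lerDl.
rewrite -ler_pdivlMr ?ltr_wpDl//.
near: w; apply: (@cvgr_dist_le _ _ _ (nbhs u) _ id u) => //.
by rewrite divr_gt0// ltr_wpDl.
Unshelve. all: by end_near. Qed.

End Dot.

(** * Minimal-norm arguments in Hilbert spaces *)

Lemma cauchy_seq_cvg {R : realType} {V : completeNormedModType R} (x : nat -> V) :
  (forall e, 0 < e ->
    exists n, forall i j, (n <= i)%N -> (n <= j)%N -> `|x i - x j| <= e) ->
  cvgn x.
Proof.
move=> xC; apply/cauchy_cvgP/cauchy_ballP => e e0; near_simpl.
have [n nP] := xC (e / 2) (divr_gt0 e0 (ltr0n _ 2)).
exists ([set i | (n <= i)%N], [set i | (n <= i)%N]); first by split; exists n.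
move=> [i j] [/= ni nj]; rewrite -ball_normE/=; apply: le_lt_trans (nP _ _ ni nj) _.
by rewrite ltr_pdivrMr// ltr_pMr// ltr1n.
Qed.

Section Hilbert.
Context {R : realType} {H : completeNormedModType R} {ip : {dot H for (@idfun R)}}.
Hypothesis hH : norm_of_dot ip.

(** Stands in for weak compactness: points of [C n] of nearly least norm form a Cauchy sequence by
    the parallelogram law, because midpoints remain in the sets and so cannot be much shorter. *)
Lemma nested_convex_nonempty (C : nat -> set H) (M : R) :
    (forall n, closed (C n)) ->
    (forall n x y, C n x -> C n y -> C n (2^-1 *: (x + y))) ->
    (forall n, C n.+1 `<=` C n) -> (forall n, C n !=set0) ->
    (forall x, C 0%N x -> `|x| <= M) ->
  exists x, forall n, C n x.
Proof.
move=> Ccl Cmid Cdecr C0 CM.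
(* [a] and [b] stand for the norms of two nearly minimal points, [s] for the norm of their sum. The
   terms [4 * D ^+ 2] cancel and a multiple of [d] remains. *)
have defect (D d a b s : R) : 0 <= D -> 0 < d <= 1 ->
    0 <= a < D + d -> 0 <= b < D + d -> 0 <= s -> D - d <= 2^-1 * s ->
    2 * a ^+ 2 + 2 * b ^+ 2 - s ^+ 2 <= d * (4 * (4 * D + 1)).
  move=> D0 /andP[d0 d1] /andP[a0 ad] /andP[b0 bd] s0 Ds.
  have a2 : a ^+ 2 <= (D + d) ^+ 2 by rewrite ler_pXn2r ?nnegrE//; lra.
  have b2 : b ^+ 2 <= (D + d) ^+ 2 by rewrite ler_pXn2r ?nnegrE//; lra.
  have s2 : 4 * (D ^+ 2 - 2 * D * d) <= s ^+ 2.
    have [Dd|dD] := leP D d; first by nra.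
    have : (2 * (D - d)) ^+ 2 <= s ^+ 2 by rewrite ler_pXn2r ?nnegrE//; lra.
    by nra.
  by nra.
have Cle n m : (n <= m)%N -> C m `<=` C n.
  by move=> /subnK <-; elim: (m - n)%N => // k IH x /Cdecr; apply: IH.
(* The supremum [D] of [low] is the limit of the nondecreasing distances from 0 to [C n]. *)
pose low := [set r : R | exists n, forall x, C n x -> r <= `|x|].
have low0 : low 0 by exists 0%N.
have lowM : ubound low M.
  move=> r [n rn]; have [x Cx] := C0 n.
  by apply: le_trans (rn x Cx) _; apply: CM; exact: (Cle 0%N n).
have lowS : has_sup low by split; [exists 0|exists M].
pose D := sup low.
have D0 : 0 <= D by apply: sup_ubound => //; exact: lowS.2.
have /choice[x xP] : forall n : nat, exists x, C n x /\ `|x| < D + n.+1%:R^-1.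
  move=> n; apply: contrapT => nx.
  suff : low (D + n.+1%:R^-1).
    move=> /(sup_ubound lowS.2); rewrite leNgt => /negP; apply.
    by rewrite ltrDl invr_gt0 ltr0n.
  exists n => x Cx; rewrite leNgt; apply/negP => xD; apply: nx; by exists x.
have xcvg : cvgn x.
  apply: cauchy_seq_cvg => e e0.
  pose c := 4 * (4 * D + 1) : R.
  have c0 : 0 < c by rewrite /c; lra.
  pose d := Num.min 1 (e ^+ 2 / c).
  have d0 : 0 < d by rewrite /d lt_min ltr01/= divr_gt0// exprn_gt0.
  have [r [n rn] Dr] := sup_adherent d0 lowS.
  have [m md] : exists m : nat, m.+1%:R^-1 < d.
    exists (Num.truncn d^-1); rewrite invf_plt ?posrE ?ltr0n//.
    exact: truncnS_gt.
  exists (maxn n m) => i j; rewrite !geq_max => /andP[ni mi] /andP[nj mj].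
  have bnd k : (m <= k)%N -> `|x k| < D + d.
    move=> mk; apply: lt_le_trans (xP k).2 _; rewrite lerD2l (le_trans _ (ltW md))//.
    by rewrite lef_pV2 ?posrE ?ltr0n// ler_nat.
  have := rn _ (Cmid n _ _ (Cle _ _ ni _ (xP i).1) (Cle _ _ nj _ (xP j).1)).
  rewrite normrZ gtr0_norm ?invr_gt0// => rij.
  rewrite -(@ler_pXn2r _ 2)// ?nnegrE ?(ltW e0)// (parallelogram hH).
  have d1 : d <= 1 by rewrite /d ge_min lexx.
  have dc : d * c <= e ^+ 2.
    by rewrite -ler_pdivlMr// /d ge_min lexx orbT.
  apply: le_trans dc; apply: defect => //; rewrite ?bnd ?d0 ?normr_ge0//.
  by apply: ltW; apply: lt_le_trans Dr rij.
exists (limn x) => n; apply: (closed_cvg _ (Ccl n) _ _ xcvg).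
by exists n => // k /= nk; apply: Cle nk _ (xP k).1.
Qed.

(** [z - p] is an element of least norm in the coset [z + V], found as a common point of the nested
    sets of near-minimizers. *)
Lemma orthogonal_projection_exists (V : set H) (z : H) :
    closed V -> V 0 -> (forall (a : R) u v, V u -> V v -> V (a *: u + v)) ->
  exists2 p, V p & forall v, V v -> ip (z - p) v = 0.
Proof.
move=> Vcl V0 Vlin.
pose low := [set `|x| | x in [set x | V (z - x)]].
have low_inf : has_inf low.
  split; first by exists `|z|, z => //=; rewrite subrr.
  by exists 0 => _ [x _ <-].
pose d := inf low.
pose C n := [set x | V (z - x) /\ `|x| <= d + n.+1%:R^-1].
have [x xP] : exists x, forall n, C n x.
  apply: (@nested_convex_nonempty C (d + 1)).
  - move=> n; apply: closedI.
      apply: (@closed_comp _ _ (fun x : H => z - x)) => // x _.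
      by apply: cvgB; [exact: cvg_cst|exact: cvg_id].
    apply: (@closed_comp _ _ (fun x : H => `|x|)) (@closed_le _ _) => x _.
    exact: norm_continuous.
  - move=> n x y [Vx xd] [Vy yd]; split.
      suff -> : z - 2^-1 *: (x + y) = 2^-1 *: (z - x) + (2^-1 *: (z - y) + 0).
        by apply: (Vlin) => //; apply: (Vlin).
      rewrite addr0 !scalerBr addrACA -opprD scalerDr -scalerDl.
      by rewrite (_ : 2^-1 + 2^-1 = 1 :> R) ?scale1r//; lra.
    rewrite normrZ gtr0_norm ?invr_gt0// ler_pdivrMl//.
    by rewrite (le_trans (ler_normD _ _))// mulr_natl mulr2n lerD.
  - move=> n x [Vx xd]; split=> //; apply: le_trans xd _.
    by rewrite lerD2l lef_pV2 ?posrE ?ltr0n// ler_nat.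
  - move=> n; have n0 : 0 < n.+1%:R^-1 :> R by rewrite invr_gt0.
    have [_ [x Vx <-] xd] := inf_adherent n0 low_inf.
    by exists x; split => //; exact: ltW.
  - by move=> x [_]; rewrite invr1.
have Vx : V (z - x) := (xP 0%N).1.
have xd : `|x| <= d.
  apply/ler_addgt0Pr => e e0.
  apply: le_trans (xP (Num.truncn e^-1)).2 _; rewrite lerD2l.
  by rewrite invf_ple ?posrE ?ltr0n// ltW// truncnS_gt.
exists (z - x) => // v Vv; rewrite subKr.
have xmin t : `|x| ^+ 2 <= `|x - t *: v| ^+ 2.
  rewrite ler_pXn2r ?nnegrE//; apply: le_trans xd _.
  apply: ge_inf; first exact: low_inf.2.
  exists (x - t *: v) => //=.
  by rewrite opprB addrCA; apply: Vlin.
have [->|v0] := eqVneq v 0; first by rewrite linear0r.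
have v_gt0 : 0 < ip v v by exact: neq0_dnorm_gt0.
(* This coefficient minimizes [|x - t *: v|] over [t]; the square drops there by
   [ip x v ^+ 2 / ip v v], so minimality of [x] forces [ip x v = 0]. *)
have := xmin (ip x v / ip v v).
rewrite !(sqr_norm_dot hH) !dotBl !dotBr !dotZl !dotZr (dotC v x) mulfVK ?gt_eqF//.
rewrite subrr subr0 -subr_ge0 addrAC subrr add0r oppr_ge0 mulrAC -expr2.
rewrite pmulr_lle0 ?invr_gt0// => xv; apply/eqP.
by rewrite -sqrf_eq0 eq_le xv sqr_ge0.
Qed.

End Hilbert.

(** * Surjectivity of coercive self-adjoint operators *)

Lemma coercive_norm_le {R : realType} {H : normedModType R}
    {ip : {dot H for (@idfun R)}} (hH : norm_of_dot ip) (A : unbounded_operator H)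
    (alpha : R) (u : H) :
  alpha * `|u| ^+ 2 <= ip (A u) u -> alpha * `|u| <= `|A u|.
Proof.
have [->|u0] := eqVneq u 0; first by rewrite normr0 mulr0.
move=> /le_trans/(_ (ler_norm _))/le_trans/(_ (dot_le_norm hH _ _)).
by rewrite expr2 mulrA ler_pM2r// normr_gt0.
Qed.

Section Surjectivity.
Context {R : realType} {H : completeNormedModType R} {ip : {dot H for (@idfun R)}}.
Hypothesis hH : norm_of_dot ip.
Variables (A : unbounded_operator H) (alpha : R).
Hypotheses (hA : self_adjoint ip A) (alpha0 : 0 < alpha).
Hypothesis A_coercive : forall u, dom A u -> alpha * `|u| ^+ 2 <= ip (A u) u.

Lemma self_adjoint_domB u v : dom A u -> dom A v ->
  dom A (u - v) /\ A (u - v) = A u - A v.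
Proof.
have [[_ Alin] _ _] := hA => Du Dv.
by rewrite addrC -scaleN1r (addrC (A u)) -[in X in _ = X]scaleN1r; apply: Alin.
Qed.

(** The bound [alpha * |u| <= |A u|] turns convergence of [A (h n)] into convergence of [h n]; the
    graph, being equal to the adjoint graph, contains the limit. *)
Lemma coercive_range_closed : closed (A @` dom A).
Proof.
move=> z zcl; have [_ _ adjE] := hA.
have /choice[h hP] : forall n : nat, exists h, dom A h /\ `|z - A h| < n.+1%:R^-1.
  move=> n; have n0 : 0 < n.+1%:R^-1 :> R by rewrite invr_gt0.
  have [_ [[h Dh <-] zh]] := zcl _ (nbhsx_ballx z _ n0).
  by exists h; split => //; move: zh; rewrite -ball_normE.
have Ah : A (h n) @[n --> \oo] --> z.
  apply/cvgrPdist_le => e e0; near=> n; apply/ltW/(lt_trans (hP n).2).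
  by near: n; exact: (near_infty_natSinv_lt (PosNum e0)).
have hcvg : cvgn h.
  apply: cauchy_seq_cvg => e e0.
  have ae : 0 < alpha * e / 2 by rewrite divr_gt0// mulr_gt0.
  have /cvgrPdist_le /(_ _ ae)[n _ nP] := Ah.
  exists n => i j ni nj; rewrite -(ler_pM2l alpha0).
  have [Dij Aij] := self_adjoint_domB (hP i).1 (hP j).1.
  apply: le_trans (coercive_norm_le hH (A_coercive Dij)) _; rewrite Aij.
  have -> : A (h i) - A (h j) = (z - A (h j)) - (z - A (h i)).
    by rewrite opprB [RHS]addrC addrA subrK.
  rewrite (le_trans (ler_normB _ _))// [leRHS](splitr (alpha * e)).
  by rewrite lerD//; apply: nP.
have : graph A (limn h, z).
  rewrite -adjE => u Du /=.
  have l1 : ip (A u) (h n) @[n --> \oo] --> ip (A u) (limn h).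
    by apply: continuous_cvg hcvg; exact: dot_continuous.
  have l2 : ip u (A (h n)) @[n --> \oo] --> ip u z.
    by apply: continuous_cvg Ah; exact: dot_continuous.
  have symA : (fun n => ip u (A (h n))) = (fun n => ip (A u) (h n)).
    apply/funext => n; have : graph A (h n, A (h n)) by split => //; exact: (hP n).1.
    by rewrite -adjE => /(_ _ Du).
  by rewrite symA in l2; exact: cvg_unique l1 l2.
by case=> /= Dh ->; exists (limn h).
Unshelve. all: by end_near. Qed.

(** Project [z] onto the closed range: the residual is orthogonal to the range, hence in the kernel
    of the adjoint, which is that of [A] and trivial by coercivity. *)
Lemma coercive_surjective z : exists2 h, dom A h & A h = z.
Proof.
have [[D0 Alin] _ adjE] := hA.
have [|a _ _ [u Du <-] [v Dv <-]|p [h Dh <-] pP] :=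
    orthogonal_projection_exists hH z coercive_range_closed.
- exists 0 => //; have := Alin (-1) 0 0 D0 D0.
  by rewrite scaler0 addr0 scaleN1r addNr => -[].
- by have [Duv <-] := Alin a _ _ Du Dv; exists (a *: u + v).
exists h => //; have : graph A (z - A h, 0).
  rewrite -adjE => u Du /=; rewrite linear0r dotC; apply: pP.
  by exists u.
case=> /= Dp Ap; have := coercive_norm_le hH (A_coercive Dp).
by rewrite -Ap normr0 pmulr_rle0// normr_le0 subr_eq0 => /eqP.
Qed.

End Surjectivity.

(** * Mean value estimates and bounds on differentials *)

(** Pairing with a fixed [y] reduces this to the scalar mean value theorem. The choice
    [y := N a - N b] yields Lipschitz bounds, [y := iB (u - v)] monotonicity. *)
Lemma differentiable_mvt_dot {R : realType} {B H : normedModType R}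
    {ip : {dot H for (@idfun R)}} (hH : norm_of_dot ip) (N : B -> H) (b h : B) (y : H) :
    (forall u, differentiable N u) ->
  exists2 c, 0 <= c <= 1 & ip y (N (b + h) - N b) = ip y ('d N (b + c *: h) h).
Proof.
move=> dN.
pose line (t : R) := b + t *: h.
pose g (t : R) : R := ip y (N (line t)).
have dg (t : R) : is_derive t (1 : R) g (ip y ('d N (line t) h)).
  have dline : is_diff t line ( *:%R^~ h).
    rewrite (_ : line = cst b + *:%R^~ h)//.
    by apply: is_diff_eq; rewrite add0r.
  have dip : is_diff (N (line t)) (ip y : H -> R^o) (ip y).
    by apply: DiffDef; [apply: linear_differentiable|apply: diff_lin];
      exact: dot_continuous.
  have dNl : is_diff (line t) N ('d N (line t)) by exact: DiffDef.
  have dg : is_diff t (g : R -> R^o) (ip y \o ('d N (line t) \o *:%R^~ h)).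
    exact: is_diff_comp.
  apply: DeriveDef; first exact/derivable1_diffP.
  by rewrite deriveE//= diff_val/= scale1r.
have [|c] := @MVT_segment R g _ 0 1 ler01 (fun t _ => dg t).
  apply: continuous_subspaceT => t.
  have [dgt _] := dg t. 
  exact/differentiable_continuous/derivable1_diffP.
rewrite in_itv/= /g /line scale1r scale0r addr0 subr0 mulr1 dotBr => c01 ->.
by exists c.
Qed.

Lemma differentiable_lipschitz {R : realType} {B H : normedModType R}
    {ip : {dot H for (@idfun R)}} (hH : norm_of_dot ip) (N : B -> H) (a b : B) (M : R) :
    (forall u, differentiable N u) ->
    (forall t h, 0 <= t <= 1 -> `|'d N (b + t *: (a - b)) h| <= M * `|h|) ->
  `|N a - N b| <= M * `|a - b|.
Proof.
move=> dN dNM.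
have [->|Nab] := eqVneq (N a) (N b).
  (* The sign of [M] is not given; the hypothesis at [t = 0] supplies [0 <= M * |a - b|]. *)
  by rewrite subrr normr0; apply: le_trans (dNM 0 _ _) => //; rewrite lexx ler01.
have [c c01] := differentiable_mvt_dot hH b (a - b) (N a - N b) dN.
rewrite [b + (a - b)]addrC subrK -sqr_norm_dot// expr2 => dNc.
have Nab0 : 0 < `|N a - N b| by rewrite normr_gt0 subr_eq0.
rewrite -(ler_pM2l Nab0) dNc (le_trans (ler_norm _))//.
by rewrite (le_trans (dot_le_norm hH _ _))// ler_wpM2l// dNM.
Qed.

(** Continuity bounds the values on the unit ball, so the [sup] in [opnorm] is a genuine supremum,
    not the default 0. *)
Lemma norm_le_opnorm {R : realType} {V W : normedModType R} (f : {linear V -> W}) (h : V) :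
  continuous f -> `|f h| <= opnorm f * `|h|.
Proof.
move=> /linear_bounded_continuous /linear_boundedP /pinfty_ex_gt0[M M0 fM].
have [->|h0] := eqVneq h 0; first by rewrite linear0 !normr0 mulr0.
have hn0 : 0 < `|h| by rewrite normr_gt0.
rewrite -ler_pdivrMr//; apply: sup_ubound.
  exists M => _ [k /= k1 <-]; apply: le_trans (fM k) _.
  by rewrite ler_piMr// ltW.
exists (`|h|^-1 *: h).
  by rewrite /= normrZ gtr0_norm ?invr_gt0// mulVf// gt_eqF.
by rewrite linearZ/= normrZ gtr0_norm ?invr_gt0// mulrC.
Qed.

(** Near each [u] the constant [1 + opnorm ('d f u)] works; phrasing the claim for all large [M]
    lets the near-covering form of compactness merge these local constants. *)
Lemma differential_bounded_on_compact {R : realType} {V W : normedModType R}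
    (f : V -> W) (Q : set V) :
    continuously_differentiable f -> compact Q ->
  exists2 M, 0 < M & forall u h, Q u -> `|'d f u h| <= M * `|h|.
Proof.
move=> [df df_cont] /compact_near_coveringP Qcov.
suff : \forall M \near +oo, Q `<=` [set u | forall h, `|'d f u h| <= M * `|h|].
  by move=> /pinfty_ex_gt0[M M0 MP]; exists M => // u h /MP; apply.
apply: Qcov => u _.
have dfu h : `|'d f u h| <= opnorm ('d f u) * `|h|.
  by apply: norm_le_opnorm; exact: diff_continuous.
have near_u : \forall v \near u, opnorm (fun h => 'd f v h - 'd f u h) <= 1.
  have /cvgrPdist_le/(_ 1 ltr01) := df_cont u.
  by apply: filterS => v; rewrite sub0r normrN; apply: le_trans; exact: ler_norm.
near=> v M => h /=.
have -> : 'd f v h = ('d f v h - 'd f u h) + 'd f u h by rewrite subrK.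
apply: le_trans (ler_normD _ _) _.
apply: (@le_trans _ _ ((1 + opnorm ('d f u)) * `|h|)).
  rewrite mulrDl lerD// ?dfu//.
  have /= := @norm_le_opnorm _ _ _ ('d f v \- 'd f u) h.
  move=> /(_ _)/le_trans-> //.
    by move=> w; apply: cvgB; exact: diff_continuous.
  rewrite ler_wpM2r//; near: v; exact: near_u.
rewrite ler_wpM2r//; near: M; exact: nbhs_pinfty_ge.
Unshelve. all: by end_near. Qed.

(** * Continuation in the parameter [t] *)

(** The last hypothesis makes the inverse of [w - s *: F w] Lipschitz with the same [C] for every
    [s]; passing from [s] to [t] is then a contraction of factor [C * (t - s) * L], so the step
    length need not shrink. *)
Lemma nonlinear_continuation {R : realType} {X : completeNormedModType R}
    (F : X -> X) (beta delta rho L C : R) :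
    0 <= L -> 0 < C -> 0 <= rho -> delta <= (1 - beta) * rho ->
    (forall w, `|w| <= rho -> `|F w| <= beta * `|w| + delta) ->
    0 <= beta ->
    (forall v w, `|v| <= rho -> `|w| <= rho -> `|F v - F w| <= L * `|v - w|) ->
    (forall t v w, 0 <= t <= 1 -> `|v| <= rho -> `|w| <= rho ->
      `|v - w| <= C * `|(v - t *: F v) - (w - t *: F w)|) ->
  exists w, F w = w.
Proof.
move=> L0 C0 rho0 rho_delta Fgrowth beta0 Flip Fexp.
(* The radius allowed for [y] shrinks with [t] at the rate at which [t *: F w]
   can grow, so that the contraction below preserves the ball of radius [rho]. *)
pose solvable t := forall y, `|y| <= (1 - t * beta) * rho - t * delta ->
  exists w, `|w| <= rho /\ w - t *: F w = y.
have step s t : 0 <= s -> s <= t -> t <= 1 -> C * (t - s) * L < 1 ->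
    solvable s -> solvable t.
  move=> s0 st t1 q1 sol y yt.
  have q0 : 0 <= C * (t - s) * L by rewrite !mulr_ge0// ?(ltW C0) ?subr_ge0.
  have Fball w : `|w| <= rho -> `|y + (t - s) *: F w| <= (1 - s * beta) * rho - s * delta.
    move=> w_rho; rewrite (le_trans (ler_normD _ _))// normrZ ger0_norm ?subr_ge0//.
    have Fw : `|F w| <= beta * rho + delta.
      by rewrite (le_trans (Fgrowth _ w_rho))// lerD2r ler_wpM2l.
    have : (t - s) * `|F w| <= (t - s) * (beta * rho + delta).
      by rewrite ler_wpM2l// subr_ge0.
    by move: yt; lra.
  (* A fixed point of [g] in the ball solves the problem at [t]. The value 0 outside the ball is
     arbitrary. *)
  have /choice[g gP] : forall w, exists v, `|w| <= rho ->
      `|v| <= rho /\ v - s *: F v = y + (t - s) *: F w.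
    move=> w; have [/Fball/sol[v vP]|w_rho] := leP `|w| rho; first by exists v.
    by exists 0.
  pose U := [set w : X | `|w| <= rho].
  have gU : {homo g : x / U x >-> U x} by move=> w /gP[].
  have [|||w /= w_rho wE] := @banach_fixed_point _ _ U (mkfun_fun gU).
  - exists (NngNum q0); split=> //= -[v w] /= [v_rho w_rho].
    have [gv gvE] := gP _ v_rho; have [gw gwE] := gP _ w_rho.
    have s1 : 0 <= s <= 1 by rewrite s0 (le_trans st).
    apply: le_trans (Fexp s _ _ s1 gv gw) _; rewrite gvE gwE.
    rewrite opprD addrACA subrr add0r -scalerBr normrZ ger0_norm ?subr_ge0//.
    by rewrite -!mulrA ler_pM2l// ler_wpM2l ?subr_ge0// Flip.
  - by apply: (@closed_comp _ _ (fun x : X => `|x|)) (@closed_le _ _) => x _;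
      exact: norm_continuous.
  - by exists 0; rewrite /U/= normr0.
  have gw : g w = w := esym wE.
  have [_] := gP _ w_rho; rewrite gw => wsE.
  exists w; split => //.
  rewrite -[y](addrK ((t - s) *: F w)) -wsE -addrA -opprD -scalerDl.
  by rewrite addrCA subrr addr0.
(* Steps of length [n.+1%:R^-1] have contraction factor [C * L / n.+1%:R < 1]. *)
have [n nP] : exists n : nat, C * L < n.+1%:R.
  by exists (Num.truncn (C * L)); exact: truncnS_gt.
have n0 : 0 < n.+1%:R :> R by rewrite ltr0n.
have sol k : (k <= n.+1)%N -> solvable (k%:R / n.+1%:R).
  elim: k => [_ y|k IHk kn].
    by rewrite !mul0r !subr0 mul1r => y_rho; exists y; rewrite scale0r subr0.
  apply: step (IHk (ltnW kn)).
  - by rewrite divr_ge0.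
  - by rewrite ler_pM2r ?invr_gt0// ler_nat.
  - by rewrite ler_pdivrMr// mul1r ler_nat.
  - rewrite -mulrBl -natrB// subSnn mulr1n mul1r mulrAC ltr_pdivrMr// mul1r.
    exact: nP.
(* At [t = 1] the admissible radius [(1 - beta) * rho - delta] is still nonnegative, so [y = 0] is
   allowed. *)
have [|w [_]] := sol n.+1 (leqnn _) 0.
  by rewrite normr0 divff ?gt_eqF// !mul1r subr_ge0.
by rewrite divff ?gt_eqF// scale1r => /subr0_eq wF; exists w.
Qed.

(** * Compact linear maps and Ehrling's inequality *)

Lemma precompact_image_linear_bounded {R : realType} {V W : normedModType R}
    (K : {linear V -> W}) :
    precompact (K @` [set z | `|z| <= 1]) ->
  exists2 M, 0 < M & forall z, `|K z| <= M * `|z|.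
Proof.
rewrite precompactE => /compact_bounded /pinfty_ex_gt0[M M0 KM].
exists M => // z; have [->|z0] := eqVneq z 0.
  by rewrite linear0 !normr0 mulr0.
have zn0 : 0 < `|z| by rewrite normr_gt0.
rewrite -ler_pdivrMr// mulrC.
have -> : `|z|^-1 * `|K z| = `|K (`|z|^-1 *: z)|.
  by rewrite linearZ normrZ gtr0_norm// invr_gt0.
apply: KM; apply: subset_closure; exists (`|z|^-1 *: z) => //=.
by rewrite normrZ gtr0_norm ?invr_gt0// mulVf ?gt_eqF.
Qed.

(* A cluster point [b] of the images [K z] of unit vectors
   with [G z] tending to [0] is attained as [b = K z] with [G z = 0], by weak
   compactness of the ball in the guise of [nested_convex_nonempty]; so, unlike in
   the usual formulation, [K z |-> G z] need not be continuous. *)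
Lemma ehrling {R : realType} {H : completeNormedModType R} {B W : normedModType R}
    {ip : {dot H for (@idfun R)}} (hH : norm_of_dot ip)
    (K : {linear H -> B}) (G : {linear H -> W}) (eps : R) :
    precompact (K @` [set z | `|z| <= 1]) -> continuous G -> injective G ->
    0 < eps ->
  exists2 C, 0 <= C & forall z, `|K z| <= eps * `|z| + C * `|G z|.
Proof.
move=> Kcpt Gcont Ginj eps0.
have [M M0 KM] := precompact_image_linear_bounded Kcpt.
have Kcont : continuous K.
  apply: bounded_linear_continuous; apply/linear_boundedP.
  exists M; split=> [|r Mr z]; first exact: num_real.
  by rewrite (le_trans (KM z))// ler_wpM2r// ltW.
(* Normalized obstructions to the inequality. If some [bad n] is empty, rescaling handles small
   [|G z|], and [M * n.+1%:R] serves as [C] for the rest. *)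
pose bad (n : nat) := [set z : H | [/\ `|z| <= 1, `|G z| <= n.+1%:R^-1 & eps <= `|K z|]].
have [[n badn]|badP] := pselect (exists n, bad n = set0).
  exists (M * n.+1%:R) => [|z]; first by rewrite mulr_ge0// ltW.
  have [->|z0] := eqVneq z 0; first by rewrite !linear0 !normr0 !mulr0 addr0.
  have zn0 : 0 < `|z| by rewrite normr_gt0.
  have nz a : 0 < a -> `|a *: z| = a * `|z| by move=> a0; rewrite normrZ gtr0_norm.
  have iz0 : 0 < `|z|^-1 by rewrite invr_gt0.
  have [Gz|Gz] := leP `|G z| (n.+1%:R^-1 * `|z|).
    have [Kz|Kz] := leP (eps * `|z|) `|K z|; last first.
      by rewrite (le_trans (ltW Kz))// lerDl !mulr_ge0// ltW.
    have : bad n (`|z|^-1 *: z).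
      rewrite /bad/= !linearZ/= !normrZ gtr0_norm// mulVf ?gt_eqF//.
      by rewrite ler_pdivrMl// mulrC Gz ler_pdivlMl// mulrC Kz.
    by rewrite badn.
  rewrite (le_trans (KM z))//.
  rewrite -[leLHS]add0r lerD//; first by rewrite mulr_ge0// ltW.
  by rewrite -mulrA ler_pM2l// -ler_pdivrMl// ltW.
exfalso.
have bad_decr m n : (m <= n)%N -> bad n `<=` bad m.
  move=> mn z [z1 Gz Kz]; split=> //; apply: le_trans Gz _.
  by rewrite lef_pV2 ?posrE ?ltr0n// ler_nat.
have bad0 n : bad n !=set0.
  by apply/set0P/eqP => badn; apply: badP; exists n.
pose F := filter_from [set: nat] (fun n => K @` bad n).
have FF : ProperFilter F.
  apply: filter_from_proper => [|n _]; last by have [z zn] := bad0 n; exists (K z), z.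
  apply: filter_from_filter; first by exists 0%N.
  move=> m n _ _; exists (maxn m n) => // _ [z zb <-].
  by split; exists z => //; apply: bad_decr zb; rewrite (leq_maxl, leq_maxr).
have [b [_ bF]] : closure (K @` [set z | `|z| <= 1]) `&` cluster F !=set0.
  move: Kcpt; rewrite precompactE; apply.
  by exists 0%N => // _ [z [z1 _ _] <-]; apply: subset_closure; exists z.
have nz n (r : R) : 0 < r -> exists z, bad n z /\ `|b - K z| <= r.
  move=> r0; have : F (K @` bad n) by exists n.
  move=> /bF/(_ (nbhsx_ballx b r r0))[_ [[z zn <-] bz]]; exists z; split=> //.
  by apply: ltW; move: bz; rewrite -ball_normE.
(* The condition [eps <= |K z|] is not convex; closeness of [K z] to [b] replaces it. *)
pose C (n : nat) := [set z : H |
  [/\ `|z| <= 1, `|G z| <= n.+1%:R^-1 & `|b - K z| <= n.+1%:R^-1]].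
have normcl (V : normedModType R) (f : H -> V) (r : R) : continuous f ->
    closed [set z | `|f z| <= r].
  move=> fc; apply: (@closed_comp _ _ (fun z => `|f z|)) (@closed_le _ _) => z _.
  by apply: continuous_comp; [exact: fc|exact: norm_continuous].
have normmid (V : normedModType R) (u v : V) (r : R) :
    `|u| <= r -> `|v| <= r -> `|2^-1 *: (u + v)| <= r.
  move=> ur vr; rewrite normrZ gtr0_norm ?invr_gt0// ler_pdivrMl//.
  by rewrite (le_trans (ler_normD _ _))// mulr_natl mulr2n lerD.
have [z zC] : exists z, forall n, C n z.
  apply: (@nested_convex_nonempty _ _ _ hH C 1).
  - move=> n; rewrite (_ : C n = [set z : H | `|z| <= 1] `&`
      ([set z | `|G z| <= n.+1%:R^-1] `&` [set z | `|b - K z| <= n.+1%:R^-1])).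
      apply: closedI; first by apply: (normcl _ id) => ?; exact: cvg_id.
      apply: closedI; first exact: normcl.
      apply: (normcl _ (fun z => b - K z)) => x.
      by apply: cvgB; [exact: cvg_cst|exact: Kcont].
    by apply/seteqP; split=> z; [case|case=> ? []].
  - move=> n x y [x1 Gx Kx] [y1 Gy Ky]; split.
    + exact: normmid.
    + by rewrite linearZ linearD; exact: normmid.
    + have -> : b - K (2^-1 *: (x + y)) = 2^-1 *: ((b - K x) + (b - K y)).
        rewrite addrACA -opprD linearZ linearD scalerBr scalerDr -scalerDl.
        by rewrite (_ : 2^-1 + 2^-1 = 1 :> R) ?scale1r//; lra.
      exact: normmid.
  - move=> n z [z1 Gz Kz]; have le_n : n.+2%:R^-1 <= n.+1%:R^-1 :> R.
      by rewrite lef_pV2 ?posrE ?ltr0n// ler_nat.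
    by split => //; exact: le_trans le_n.
  - move=> n; have n0 : 0 < n.+1%:R^-1 :> R by rewrite invr_gt0.
    by have [z [[z1 Gz _] Kz]] := nz n _ n0; exists z.
  - by move=> z [].
have inv_small (x : R) : (forall n : nat, x <= n.+1%:R^-1) -> x <= 0.
  move=> xn; apply/ler_addgt0Pr => e e0; rewrite add0r.
  apply: le_trans (xn (Num.truncn e^-1)) _.
  by rewrite invf_ple ?posrE ?ltr0n// ltW// truncnS_gt.
have Gz : G z = 0.
  by apply/eqP; rewrite -normr_le0; apply: inv_small => n; have [] := zC n.
have bK : b = K z.
  apply/subr0_eq/eqP; rewrite -normr_le0.
  by apply: inv_small => n; have [] := zC n.
have z0 : z = 0 by apply: Ginj; rewrite Gz linear0.
(* Since [b = 0], some [v] in [bad 0] has [|K v| <= eps / 2], against [eps <= |K v|]. *)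
have [v [[_ _ Kv] ]] := nz 0%N _ (divr_gt0 eps0 (ltr0n _ 2)).
rewrite bK z0 linear0 sub0r normrN => /(le_trans Kv).
by rewrite leNgt ltr_pdivrMr// ltr_pMr// ltr1n.
Qed.

(** * Reduction of [A x = N x] to a fixed point of [N] after the inverse of [A] *)

Theorem theorem2 (R : realType)
  (H : completeNormedModType R) (ip : {dot H for (@idfun R)})
  (hH : norm_of_dot ip)
  (A : unbounded_operator H) (hA : self_adjoint ip A)
  (B : completeNormedModType R) (iB : {linear B -> H}) (hiB : injective iB)
  (N : B -> H)
  (A1 : compact_inclusion ip A iB)
  (alpha : R) (halpha : 0 < alpha)
  (A2 : forall u : H, dom A u -> alpha * `|u| ^+ 2 <= ip (A u) u)
  (N1_C1 : continuously_differentiable N)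
  (N1_sym : forall u h k : B, ip ('d N u h) (iB k) = ip (iB h) ('d N u k))
  (beta gamma delta : R)
  (hbeta : 0 < beta < 1) (hgamma : 0 < gamma < alpha) (hdelta : 0 < delta)
  (N2_i : forall u : B, dom A (iB u) ->
    `|N u| < beta * `|A (iB u)| + delta)
  (N2_ii : forall u h : B, dom A (iB u) -> dom A (iB h) -> h != 0 ->
    ip ('d N u h) (iB h) < gamma * `|iB h| ^+ 2) :
  exists! x : H, dom A x /\ exists2 u : B, iB u = x & A x = N u.
Proof.
have [b0 b1] := andP hbeta; have [g0 ga] := andP hgamma.
have [A_dom A_cpt] := A1; have [dN _] := N1_C1.
have [[D0 Alin] _ _] := hA.
have domB u v : dom A (iB u) -> dom A (iB v) ->
    dom A (iB (u - v)) /\ A (iB (u - v)) = A (iB u) - A (iB v).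
  by move=> Du Dv; rewrite linearB; exact: (self_adjoint_domB hA).
have domP (a : R) u v : dom A (iB u) -> dom A (iB v) -> dom A (iB (a *: u + v)).
  by move=> Du Dv; rewrite linearP; have [] := Alin a _ _ Du Dv.
have N_monotone u v : dom A (iB u) -> dom A (iB v) ->
    ip (N u - N v) (iB (u - v)) <= gamma * `|iB (u - v)| ^+ 2.
  move=> Du Dv; have [->|uv] := eqVneq (u - v) 0.
    by rewrite linear0 linear0r normr0 expr0n mulr0.
  have [c _] := differentiable_mvt_dot hH v (u - v) (iB (u - v)) dN.
  have [Duv _] := domB _ _ Du Dv.
  rewrite [v + (u - v)]addrC subrK dotC => ->; rewrite dotC; apply/ltW/N2_ii => //.
  by rewrite addrC; exact: domP.
have A_inj u v : dom A (iB u) -> dom A (iB v) -> A (iB u) = A (iB v) -> u = v.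
  move=> Du Dv Auv; have [Duv Auv0] := domB _ _ Du Dv.
  have := coercive_norm_le hH (A2 _ Duv).
  rewrite Auv0 Auv subrr normr0 pmulr_rle0// normr_le0 -(linear0 iB) => /eqP/hiB.
  exact: subr0_eq.
(* [K] is the inverse of [A] with values in [B]; below, [G] is the same inverse with values in
   [H]. *)
have /choice[K KP] : forall z, exists u, dom A (iB u) /\ A (iB u) = z.
  move=> z; have [h Dh Ah] := coercive_surjective hH hA halpha A2 z.
  by have [u _ uh] := A_dom _ Dh; exists u; rewrite uh.
have KE u : dom A (iB u) -> K (A (iB u)) = u.
  by move=> Du; apply: A_inj => //; have [] := KP (A (iB u)).
have Klin : linear K.
  move=> a y z; have [Dy Ay] := KP y; have [Dz Az] := KP z.
  rewrite -[in LHS]Ay -[in LHS]Az; have [_ <-] := Alin a _ _ Dy Dz.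
  by rewrite -linearP KE//; exact: domP.
pose Klm := GRing.isLinear.Build R H B *:%R K Klin.
pose KL : {linear H -> B} := HB.pack K Klm.
pose G : {linear H -> H} := iB \o KL.
have G_le z : alpha * `|G z| <= `|z|.
  by have [Dz Az] := KP z; have := coercive_norm_le hH (A2 _ Dz); rewrite Az.
have Gcont : continuous G.
  apply: bounded_linear_continuous; apply/linear_boundedP.
  exists alpha^-1; split=> [|r /ltW r_alpha z]; first exact: num_real.
  apply: le_trans (ler_wpM2r (normr_ge0 z) r_alpha).
  by rewrite mulrC ler_pdivlMr// mulrC.
have Ginj : injective G.
  by move=> y z /= /hiB yz; have [_ <-] := KP y; have [_ <-] := KP z; rewrite yz.
(* The inverse of [A] sends balls of [H] to sets bounded in the graph norm, which (A1) makes
   precompact in [B]. *)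
have Kcpt (r : R) : precompact (KL @` [set z | `|z| <= r]).
  apply: (@precompact_subset _ _ (iB @^-1` (G @` [set z | `|z| <= r]))).
    by move=> _ [z z_r <-]; exists z.
  apply: A_cpt => [_ [z _ <-]|]; first by have [] := KP z.
  exists (Num.sqrt ((alpha^-1 * r) ^+ 2 + r ^+ 2)) => _ [z /= z_r <-].
  have r0 : 0 <= r by exact: le_trans z_r.
  have Gz : `|G z| <= alpha^-1 * r by rewrite ler_pdivlMl// (le_trans (G_le z)).
  have [_ Az] := KP z; rewrite /graph_norm /graph_dot Az -!(sqr_norm_dot hH).
  by apply: ler_wsqrtr; rewrite lerD// ler_pXn2r ?nnegrE ?mulr_ge0 ?invr_ge0 ?(ltW halpha)//.
have domK z : dom A (iB (K z)) by have [] := KP z.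
have AK z : A (iB (K z)) = z by have [] := KP z.
pose F z := N (K z).
(* Chosen so that [beta * rho + delta = rho]. *)
pose rho := delta / (1 - beta).
have rho0 : 0 < rho by rewrite divr_gt0// subr_gt0.
pose Q := closure (KL @` [set z | `|z| <= rho]).
have Qcpt : compact Q by rewrite -precompactE; exact: Kcpt.
have [M M0 dNM] := differential_bounded_on_compact N1_C1 Qcpt.
(* The bound keeps [KL (v - w)] instead of [|v - w|], so that Ehrling's inequality can be applied to
   it. *)
have F_le v w : `|v| <= rho -> `|w| <= rho -> `|F v - F w| <= M * `|KL (v - w)|.
  move=> vr wr; rewrite linearB; apply: (@differentiable_lipschitz _ _ _ _ hH N (KL v) (KL w)) => // t h t01.
  (* The ball is convex, so the segment from [KL w] to [KL v] stays in [Q]. *)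
  apply: dNM; apply: subset_closure; exists (w + t *: (v - w)).
    have [t0 t1] := andP t01.
    rewrite /= (_ : w + _ = (1 - t) *: w + t *: v); last first.
      by rewrite scalerBr scalerBl scale1r addrA addrAC.
    rewrite (le_trans (ler_normD _ _))// !normrZ ger0_norm ?subr_ge0// ger0_norm//.
    have : (1 - t) * `|w| <= (1 - t) * rho by rewrite ler_wpM2l// subr_ge0.
    have : t * `|v| <= t * rho by rewrite ler_wpM2l.
    by lra.
  by rewrite linearD linearZ linearB.
have [k k0 Kk] := precompact_image_linear_bounded (Kcpt 1).
(* With this [eps], the term [M * eps * |z|] is half of [|z|] and can be absorbed on the left. *)
have eps0 : 0 < (2 * M)^-1 by rewrite invr_gt0 mulr_gt0.
have [C C0 KC] := ehrling hH (Kcpt 1) Gcont Ginj eps0.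
(* The expansiveness constant results from solving [|z| <= |r| + |z| / 2 + M * C * |r| / (alpha -
   gamma)] for [|z|]. *)
have [||||||||w wF] := @nonlinear_continuation R H F beta delta rho (M * k)
  (2 * (1 + M * C / (alpha - gamma))).
- by rewrite mulr_ge0// ltW.
- by rewrite mulr_gt0// ltr_wpDr// divr_ge0 ?subr_ge0 ?(ltW ga)// mulr_ge0// ltW.
- exact: ltW.
- by rewrite mulrC divfK// gt_eqF// subr_gt0.
- by move=> w _; have := N2_i _ (domK w); rewrite AK => /ltW.
- exact: ltW.
- move=> v w vr wr; rewrite (le_trans (F_le _ _ vr wr))// -mulrA ler_pM2l//.
- move=> t v w /andP[t0 t1] vr wr.
  set r := (v - _) - _; pose z := v - w.
  have rE : z = r + t *: (F v - F w).
    by rewrite /r opprB scalerBr [RHS]addrAC !addrA !subrK.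
  (* Pair [z = r + t *: (F v - F w)] with [G z]: coercivity bounds the left side below by
     [alpha * |G z| ^+ 2], monotonicity bounds the [t] term above by [gamma * |G z| ^+ 2]. *)
  have Gz : (alpha - gamma) * `|G z| <= `|r|.
    have [->|Gz0] := eqVneq (G z) 0; first by rewrite normr0 mulr0.
    have Gz_gt0 : 0 < `|G z| by rewrite normr_gt0.
    rewrite -(ler_pM2r Gz_gt0) -mulrA -expr2 mulrBl lerBlDr.
    have := A2 _ (domK z); rewrite AK => /le_trans; apply.
    rewrite {1}rE dotDl dotZl; apply: lerD.
      by rewrite (le_trans (ler_norm _))// dot_le_norm.
    apply: (@le_trans _ _ (t * (gamma * `|G z| ^+ 2))).
      rewrite ler_wpM2l//.
      by have := N_monotone _ _ (domK v) (domK w); rewrite -(linearB KL).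
    by rewrite ler_piMl// mulr_ge0 ?sqr_ge0// ltW.
  have zr : `|z| <= `|r| + M * ((2 * M)^-1 * `|z| + C * `|G z|).
    rewrite {1}rE (le_trans (ler_normD _ _))// lerD2l normrZ ger0_norm//.
    apply: (@le_trans _ _ `|F v - F w|); first by rewrite ler_piMl.
    by rewrite (le_trans (F_le _ _ vr wr))// ler_pM2l.
  have MM : M * (2 * M)^-1 = 2^-1 by rewrite invfM mulrCA mulfV ?gt_eqF// mulr1.
  have Gr : `|G z| <= `|r| / (alpha - gamma).
    by rewrite ler_pdivlMr ?subr_gt0// mulrC.
  have MCG : M * C * `|G z| <= M * C / (alpha - gamma) * `|r|.
    by rewrite -[leRHS]mulrA [_^-1 * _]mulrC ler_wpM2l// mulr_ge0// ltW.
  rewrite -[2 * _ * _]mulrA mulrDl mul1r; rewrite mulrDr !mulrA MM in zr.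
  by move: zr MCG; rewrite -/z; lra.
exists (G w); split; first by split; [exact: domK|exists (K w); rewrite ?AK].
move=> x [Dx [u ux Axu]]; rewrite -{}ux in Dx Axu *; congr (iB _); apply/esym.
have [Duw Auw] := domB _ _ Dx (domK w).
(* For the difference [d] of two solutions, [alpha * |d| ^+ 2 <= ip (A d) d <= gamma * |d| ^+ 2], so
   [d = 0]. *)
have := N_monotone _ _ Dx (domK w).
rewrite -Axu -/(F w) wF -{1}(AK w) -Auw => /(le_trans (A2 _ Duw)).
rewrite -subr_ge0 -mulrBl nmulr_rge0 ?subr_lt0// exprn_even_le0//= normr_eq0.
by rewrite -(linear0 iB) => /eqP/hiB; exact: subr0_eq.
Qed.
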